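(* Let $b_0>0$ and let $\vec v=\{v_n\}_{n\ge 0}$ be a real sequence with $1=v_0\le v_1\le v_2\le\cdots$ satisfying, for all integers $n\ge 2$ and $p\ge 1$ with $2p\le n$, $$v_{n-2}v_{2p-1}+v_{2p-3}v_{n-2p}=v_nv_{2p-3}+v_{2p-1}v_{n-2p}$$ (with $v_{-1}:=0$), and such that $v_n>v_{n-2}$ for all $n\ge 2$. Let $\{\psi_n(x)\}_{n\ge 0}$ be the orthonormal Hermite-Chihara polynomial system constructed from $\vec v$ and $b_0$, and let $\overline{B_1}$ be the operator associated with $\vec v$ (both defined in the context). Then the following two conditions are equivalent. (i) There exist real sequences $\{\overline{\delta_n}\}_{n\ge 2}$ and $\{\overline{\beta_n}\}_{n\ge 3}$ such that $$\overline{B_1}\psi_2=\overline{\delta_2}\,x\,\psi_1,\qquad \overline{B_1}\psi_n=\overline{\delta_n}\,x\,\psi_{n-1}+\overline{\beta_n}\,\psi_{n-2}\quad\text{for all } n\ge 3 .$$ (ii) The sequence $\vec v$ satisfies, with some $v_1,v_2$ such that $1\le v_1\le v_2$, $$v_{2p+1}=(p+1)v_1\quad (p\ge 1),\qquad v_{2m}=m v_2-(m-1)\quad (m\ge 1).$$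
   Context: Given $b_0>0$ and $\vec v$ as in the claim, define positive numbers $b_{n}$ by $$b_{n-1}^2=b_0^2\,\frac{v_{n-1}(v_n-v_{n-2})}{v_1},\qquad n\ge 2 .$$ The Hermite-Chihara polynomial system constructed from $\vec v$ and $b_0$ is the sequence of real polynomials $\{\psi_n\}_{n\ge0}$ determined by $$\psi_0(x)=1,\qquad \psi_1(x)=\frac{x}{b_0},\qquad x\psi_n(x)=b_n\psi_{n+1}(x)+b_{n-1}\psi_{n-1}(x)\quad(n\ge 1).$$ (These polynomials are orthonormal with respect to some symmetric probability measure on $\mathbb{R}$, namely a solution of the Hamburger moment problem for the Jacobi matrix with zero diagonal and off-diagonal entries $b_0,b_1,\dots$.) The coefficients $\varepsilon_k$ associated with $\vec v$ are defined recursively by $$\varepsilon_1=v_0=1,\qquad \varepsilon_k=\frac{v_{k-1}}{k!}-\varepsilon_{k-1}-\frac{\varepsilon_{k-2}}{2!}-\cdots-\frac{\varepsilon_1}{(k-1)!}\quad (k\ge 2).$$ The operator $\overline{B_1}$ acts on polynomials in $x$ by $$\overline{B_1}=\sum_{k=2}^{\infty}\varepsilon_k x^k\frac{d^k}{dx^k}$$ (a finite sum on each polynomial). Thus the generalized derivation operator $D_{\vec v}$, given by $D_{\vec v}x^0=0$ and $D_{\vec v}x^n=v_{n-1}x^{n-1}$ for $n\ge1$, equals $\frac{d}{dx}+x^{-1}\overline{B_1}$. *)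

(* Defs.v *)
From mathcomp Require Import all_boot all_order all_algebra.
From mathcomp Require Import reals.

Set Implicit Arguments.
Unset Strict Implicit.
Unset Printing Implicit Defensive.

Import Order.TTheory GRing.Theory Num.Theory.

Local Open Scope ring_scope.

Section Definitions.
Variable R : realType.
Implicit Types (v b : nat -> R) (p : {poly R}).

(* v with integer indices: v_z for z >= 0 and the convention v_z = 0 for
   z < 0, of which only v_(-1) = 0 is ever used *)
Definition zindexed v (z : int) : R := if z is Posz n then v n else 0.

Definition hc_coef (b0 : R) v (n : nat) : R :=
  if n is m.+1 then Num.sqrt (b0 ^+ 2 * (v n * (v n.+1 - v m) / v 1%N))
  else b0.

Fixpoint jacobi_poly b (n : nat) : {poly R} :=
  match n with
  | 0 => 1
  | m.+1 => match m with
            | 0 => (b 0%N)^-1 *: 'X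
            | k.+1 => (b m)^-1 *: ('X * jacobi_poly b m - b k *: jacobi_poly b k)
            end
  end.

Definition hc_poly (b0 : R) v : nat -> {poly R} := jacobi_poly (hc_coef b0 v).

(* the list epsilon_1, ..., epsilon_n; its item at position j is
   epsilon_(j+1), see epsE for the recursion in the original indexing *)
Fixpoint eps_seq v (n : nat) : seq R :=
  if n is m.+1 then
    rcons (eps_seq v m)
      (v m / (m.+1)`!%:R - \sum_(j < m) (eps_seq v m)`_j / (m - j)`!%:R)
  else [::].

Definition eps v (k : nat) : R := (eps_seq v k)`_k.-1.

(* p^`(k) = 0 for k >= size p, so the bound size p loses no term *)
Definition B1 v p : {poly R} :=
  \sum_(2 <= k < size p) eps v k *: ('X^k * p^`(k)).

Lemma hc_coef_gt0 (b0 : R) v n : 0 < b0 ->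
  (forall n, 0 < v n) -> (forall n, (2 <= n)%N -> v (n - 2)%N < v n) ->
  0 < hc_coef b0 v n.
Proof.
move=> b0p vp vi; case: n => [//|n]; rewrite /hc_coef sqrtr_gt0.
have := vi n.+2 isT; rewrite subn2 /= => vin.
by rewrite !(mulr_gt0, invr_gt0, exprn_gt0, subr_gt0).
Qed.

Lemma hc_coef_sqr (b0 : R) v n :
  (forall n, 0 < v n) -> (forall n, (2 <= n)%N -> v (n - 2)%N < v n) ->
  (2 <= n)%N ->
  hc_coef b0 v n.-1 ^+ 2 = b0 ^+ 2 * (v n.-1 * (v n - v (n - 2)%N) / v 1%N).
Proof.
move=> vp vi; case: n => [|[|n]] // n2; have := vi _ n2.
rewrite subn2 /hc_coef /= => vin; rewrite sqr_sqrtr //.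
by rewrite mulr_ge0 ?sqr_ge0 // ltW // !(mulr_gt0, invr_gt0, subr_gt0).
Qed.

Lemma jacobi_poly_rec b n : (forall n, b n != 0) -> (1 <= n)%N ->
  'X * jacobi_poly b n =
    b n *: jacobi_poly b n.+1 + b n.-1 *: jacobi_poly b n.-1.
Proof.
by move=> b0; case: n => // n _; rewrite [jacobi_poly b n.+2]/= scalerA mulfV //
  scale1r subrK.
Qed.

Lemma size_eps_seq v n : size (eps_seq v n) = n.
Proof. by elim: n => //= n IH; rewrite size_rcons IH. Qed.

Lemma nth_eps_seq v n j : (j < n)%N -> (eps_seq v n)`_j = eps v j.+1.
Proof.
elim: n => // n IH; rewrite ltnS leq_eqVlt => /orP[/eqP -> //|jn].
by rewrite /= nth_rcons size_eps_seq jn IH.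
Qed.

Lemma epsE v k : (1 <= k)%N ->
  eps v k = v k.-1 / k`!%:R - \sum_(1 <= j < k) eps v j / (k - j)`!%:R.
Proof.
case: k => // k _; rewrite {1}/eps /= nth_rcons size_eps_seq ltnn eqxx.
congr (_ - _); rewrite big_add1 big_mkord; apply: eq_bigr => j _.
by rewrite nth_eps_seq // subSS.
Qed.

End Definitions.

(* Main.v *)
(* [B1 v] maps [x^n] to [(v_(n-1) - n) x^n] (and 1 to 0). Comparing the
   coefficients of the degree 4 identity in (i): the constant term forces
   [beta_4 = 0], and then those of [x^4] and [x^2] give [v_3 = 2 v_1]. The
   quadratic relation at [p = 2] now reads [v_n = 2 v_(n-2) - v_(n-4)], whence
   (ii). Conversely, under (ii) the monic polynomials [P_n] are generalized
   Hermite polynomials, and [B1 v] acts as [(v_1 - 2)/2 x d/dx] on even and as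
   [(v_2 - 3)/2 (x d/dx - 1)] on odd polynomials; the classical formulas for
   [P_n'] then give (i). *)
Require Import Defs.
From mathcomp Require Import all_boot all_order all_algebra.
From mathcomp Require Import reals.
From mathcomp Require Import ring lra zify.

Set Implicit Arguments.
Unset Strict Implicit.
Unset Printing Implicit Defensive.

Import Order.TTheory GRing.Theory Num.Theory.

Local Open Scope ring_scope.

Section HermiteChihara.
Variable R : realType.
Implicit Types (v a b : nat -> R) (p : {poly R}).

(** * Eigenvalues of [B1 v] on monomials *)

(** This is the recursion for eps_(n+1) multiplied by (n+1)!. The sum starts at k = 1, so for v_0 =
    1 it includes d/dx: the full derivation sends x^(n+1) to v_n x^n. *)
Lemma sum_eps_ffact v n :
  \sum_(1 <= k < n.+2) eps v k *+ n.+1 ^_ k = v n.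
Proof.
have fN m : m`!%:R != 0 :> R by rewrite pnatr_eq0 -lt0n fact_gt0.
have ffactE k : (k < n.+2)%N -> (n.+1 ^_ k)%:R = (n.+1)`!%:R / (n.+1 - k)`!%:R :> R.
  by move=> kn; rewrite -(@ffact_fact n.+1 k kn) natrM mulfK.
rewrite big_nat_recr //= ffactnn [eps v n.+1]epsE //= mulrnBl.
rewrite -[_ / _ *+ _]mulr_natr divfK // addrC -sumrMnl.
rewrite [X in _ + X](_ : _ = \sum_(1 <= k < n.+1)
  eps v k / (n.+1 - k)`!%:R *+ (n.+1)`!) ?subrK //.
rewrite big_nat [RHS]big_nat; apply: eq_bigr => k /andP[_ kn].
by rewrite -[LHS]mulr_natr -[RHS]mulr_natr ffactE 1?ltnW // mulrA mulrAC.
Qed.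

(* [x^n] is an eigenvector of [B1 v]: dividing [sum_(k >= 1) eps_k n^_k] by
   [n!] gives back the recursion defining [eps]. *)
Definition B1_eigenvalue v n : R := if n is m.+1 then v m - n%:R else 0.

Lemma coef_B1 v p n : v 0 = 1 -> (B1 v p)`_n = B1_eigenvalue v n * p`_n.
Proof.
move=> v0; rewrite /B1 coef_sum.
have [szn|nsz] := leqP (size p) n.
  rewrite [p`_n]nth_default // mulr0 big1_seq // => k _.
  rewrite coefZ coefXnM coef_derivn; case: ltnP => kn; rewrite ?mulr0 //.
  by rewrite subnKC // nth_default // mul0rn mulr0.
case: n nsz => [|n] nsz.
  rewrite mul0r big_nat big1 // => k /andP[k2 _].
  by rewrite coefZ coefXnM (leq_trans _ k2) // mulr0.
rewrite (@big_cat_nat _ _ _ n.+2) //= [X in _ + X]big_nat.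
rewrite [X in _ + X]big1 ?addr0; last first.
  by move=> k /andP[nk _]; rewrite coefZ coefXnM nk mulr0.
have eps1 : eps v 1 = 1 by rewrite epsE // big_geq // subr0 v0 divr1.
(* As eps_1 = 1, the k = 1 term is n+1; removing it from the full sum leaves the eigenvalue. *)
rewrite -(sum_eps_ffact v n) [in RHS]big_ltn // ffactn1.
rewrite eps1 [_ + \sum_(_ <= _ < _) _]addrC addrK mulr_suml.
rewrite !big_nat; apply: eq_bigr => k /andP[_ kn].
rewrite coefZ coefXnM coef_derivn ltnNge -ltnS kn /= subnKC //.
by rewrite mulrnAr mulrnAl.
Qed.

Lemma B1_scale v c p : v 0 = 1 -> B1 v (c *: p) = c *: B1 v p.
Proof.
by move=> v0; apply/polyP => n; rewrite coefZ !coef_B1 // coefZ mulrCA.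
Qed.

(** * Monic recurrence polynomials and their derivatives *)

Fixpoint monic_jacobi a (n : nat) : {poly R} :=
  match n with
  | 0 => 1
  | m.+1 => if m is k.+1 then
              'X * monic_jacobi a m - (a k)%:P * monic_jacobi a k
            else 'X
  end.

Lemma monic_jacobiSS a n :
  monic_jacobi a n.+2 = 'X * monic_jacobi a n.+1 - (a n)%:P * monic_jacobi a n.
Proof. by []. Qed.

(** Dividing out the leading coefficient leaves only the squares b_i^2 in the recurrence, so the
    square roots of [hc_coef] disappear. *)
Lemma jacobi_poly_monic b n : (forall i, b i != 0) ->
  jacobi_poly b n =
    (\prod_(i < n) b i)^-1 *: monic_jacobi (fun i => b i ^+ 2) n.
Proof.
move=> bN; have wN m : \prod_(i < m) b i != 0 by apply/prodf_neq0.
suff: jacobi_poly b n =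
    (\prod_(i < n) b i)^-1 *: monic_jacobi (fun i => b i ^+ 2) n /\
  jacobi_poly b n.+1 =
    (\prod_(i < n.+1) b i)^-1 *: monic_jacobi (fun i => b i ^+ 2) n.+1 by case.
elim: n => [|n [IH0 IH1]].
  by rewrite big_ord0 big_ord1 invr1 scale1r.
split=> //; rewrite monic_jacobiSS.
have -> : jacobi_poly b n.+2 =
  (b n.+1)^-1 *: ('X * jacobi_poly b n.+1 - b n *: jacobi_poly b n) by [].
rewrite IH0 IH1 -scalerAr !big_ord_recr /= scalerBr !scalerA mul_polyC.
rewrite scalerBr !scalerA !invfM; congr (_ *: _ - _ *: _).
  by rewrite mulrC.
by move: (bN n) (bN n.+1) (wN n) => b1 b2 b3; field; rewrite b1 b2 b3.
Qed.

Lemma monic_jacobi_parity a n i : odd (n + i) -> (monic_jacobi a n)`_i = 0.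
Proof.
suff: (forall i, odd (n + i) -> (monic_jacobi a n)`_i = 0) /\
      (forall i, odd (n.+1 + i) -> (monic_jacobi a n.+1)`_i = 0).
  by case=> H _; apply: H.
elim: n => [|n [IH0 IH1]]; split=> //.
- by case=> [|j]; rewrite // coef1.
- by case=> [|[|j]]; rewrite // coefX.
move=> j; rewrite monic_jacobiSS !addSn /= negbK => oj.
rewrite coefB coefXM coefCM IH0 // mulr0 subr0.
by case: j oj => //= j oj; apply: IH1; rewrite addSn -addnS.
Qed.

(* For [s = 2] and [A = 1/2] these are the Hermite polynomials, with
   [P_n' = n P_(n-1)]; in general only the even degrees keep this form, and the
   induction needs both parities at once. *)
Lemma monic_jacobi_deriv a (A s : R) :
  (forall k, a (2 * k)%N = A * (1 + k%:R * s)) ->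
  (forall k, a (2 * k + 1)%N = A * (k%:R * s + s)) ->
  forall k,
    (monic_jacobi a (2 * k + 2))^`() =
      (2 * k + 2)%:R * monic_jacobi a (2 * k + 1) /\
    'X * (monic_jacobi a (2 * k + 3))^`() =
      monic_jacobi a (2 * k + 3)
      + (2 * k + 2)%:R * ('X * monic_jacobi a (2 * k + 2))
      + (2 * k + 2)%:R * A%:P * monic_jacobi a (2 * k + 1).
Proof.
move=> aE aO; elim=> [|k [E O]].
  have := aE 0%N; have := aO 0%N; rewrite !mul0r add0r addr0 mulr1 /= => a1 a0.
  rewrite a0 a1 !derivE polyCM; split; ring.
have -> : (2 * k.+1 + 2 = (2 * k + 2).+2)%N by lia.
have -> : (2 * k.+1 + 3 = (2 * k + 3).+2)%N by lia.
have -> : (2 * k.+1 + 1 = 2 * k + 3)%N by lia.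
have E3 : monic_jacobi a (2 * k + 3) =
    'X * monic_jacobi a (2 * k + 2) - (a (2 * k + 1)%N)%:P * monic_jacobi a (2 * k + 1).
  by rewrite !addnS addn0.
have E4 : monic_jacobi a (2 * k + 2).+2 =
    'X * monic_jacobi a (2 * k + 3) - (a (2 * k + 2)%N)%:P * monic_jacobi a (2 * k + 2).
  by rewrite !addnS addn0.
have E5 : monic_jacobi a (2 * k + 3).+2 =
    'X * monic_jacobi a (2 * k + 2).+2 - (a (2 * k + 3)%N)%:P * monic_jacobi a (2 * k + 3).
  by rewrite !addnS addn0.
have aE2 : a (2 * k + 2)%N = A * (1 + k.+1%:R * s).
  by rewrite -aE; congr a; lia.
have aO2 : a (2 * k + 3)%N = A * (k.+1%:R * s + s).
  by rewrite -aO; congr a; lia.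
(* Differentiating [E4] produces X P_(2k+3)', known from [O]. Since a_(2k+2) - A = a_(2k+1), the
   terms with factor 2k+2 sum to (2k+2) P_(2k+3) by [E3]. *)
have E' : (monic_jacobi a (2 * k + 2).+2)^`() =
    (2 * k + 2).+2%:R * monic_jacobi a (2 * k + 3).
  rewrite E4 !(derivB, derivM, derivX, derivC) O E E3 aO aE2.
  rewrite !polyCM !polyCD !polyCM !polyC_natr; ring.
split=> //.
rewrite E5 derivB !derivM derivX derivC mul0r add0r mul1r E' mulrBr [X in _ - X]mulrCA O E4 E3 aO aE2 aO2.
by rewrite !polyCM !polyCD !polyCM !polyC_natr; ring.
Qed.

(** * Action of [B1 v] in each parity under (ii) *)

(** For n = 2m, v_(n-1) = m v_1 makes the eigenvalue v_(n-1) - n proportional to n, the eigenvalue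
    of x d/dx. *)
Lemma B1_even v p : v 0 = 1 ->
  (forall k, v (2 * k + 1)%N = k.+1%:R * v 1%N) ->
  (forall i, odd i -> p`_i = 0) ->
  B1 v p = ((v 1%N - 2) / 2) *: ('X * p^`()).
Proof.
move=> v0 vO pE; apply/polyP => i; rewrite coef_B1 // coefZ coefXM coef_deriv.
case: i => [|i] /=; first by rewrite mul0r mulr0.
have [oi|ei] := boolP (odd i); last by rewrite pE // mul0rn !mulr0.
have -> : v i = i.+1%:R / 2 * v 1%N.
  have -> : i = (2 * i./2 + 1)%N by have := odd_double_half i; rewrite oi; lia.
  by rewrite vO; field.
by rewrite -[_ *+ _]mulr_natr; field.
Qed.

(** For odd n the eigenvalue v_(n-1) - n is proportional to n - 1, the eigenvalue of x d/dx - 1. *)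
Lemma B1_odd v p : v 0 = 1 ->
  (forall k, v (2 * k)%N = 1 + k%:R * (v 2%N - 1)) ->
  (forall i, ~~ odd i -> p`_i = 0) ->
  B1 v p = ((v 2%N - 3) / 2) *: ('X * p^`() - p).
Proof.
move=> v0 vE pO; apply/polyP => i.
rewrite coef_B1 // coefZ coefB coefXM coef_deriv.
case: i => [|i] /=; first by rewrite pO // subr0 !mulr0.
have [oi|ei] := boolP (odd i).
  by rewrite pO /= ?oi // mul0rn subr0 !mulr0.
have -> : v i = 1 + i%:R / 2 * (v 2%N - 1).
  have -> : i = (2 * i./2)%N by have := odd_double_half i; rewrite (negbTE ei); lia.
  by rewrite vE; field.
by rewrite -[_ *+ _]mulr_natr; field.
Qed.

(** This carries relations as in (i) from the orthonormal to the monic system and back. *)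
Lemma B1_rescale v p q r x y z d e : v 0 = 1 -> y != 0 -> z != 0 ->
  B1 v p = d *: ('X * q) + e *: r ->
  B1 v (x *: p) = (x * d / y) *: ('X * (y *: q)) + (x * e / z) *: (z *: r).
Proof.
move=> v0 yN zN H; rewrite B1_scale // H scalerDr -scalerAr !scalerA.
by rewrite !divfK.
Qed.

(** In even degree the derivative is a multiple of the preceding polynomial, so no lower term
    appears; in odd degree X P' - P leaves both terms. *)
Lemma B1_monic_jacobi a v (A : R) : v 0 = 1 ->
  (forall k, v (2 * k + 1)%N = k.+1%:R * v 1%N) ->
  (forall k, v (2 * k)%N = 1 + k%:R * (v 2%N - 1)) ->
  (forall k, a (2 * k)%N = A * v (2 * k)%N) ->
  (forall k, a (2 * k + 1)%N = A * (k.+1%:R * (v 2%N - 1))) ->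
  forall n, B1 v (monic_jacobi a n.+2) =
    (if odd n then (v 2%N - 3) / 2 * n.+1%:R else (v 1%N - 2) / 2 * n.+2%:R)
      *: ('X * monic_jacobi a n.+1)
    + (if odd n then (v 2%N - 3) / 2 * n.+1%:R * A else 0) *: monic_jacobi a n.
Proof.
move=> v0 vO vE aE aO n.
have D := @monic_jacobi_deriv a A (v 2%N - 1) (fun k => _) (fun k => _) n./2.
have {D} [|| DE DO] := D.
- by move=> k; rewrite aE vE.
- by move=> k; rewrite aO; ring.
have := odd_double_half n; case: ifP => on nE.
  rewrite B1_odd //; last first.
    by move=> i ei; apply: monic_jacobi_parity; rewrite oddD /= on (negbTE ei).
  have [n1 n2 n3] : [/\ (2 * n./2 + 1 = n)%N, (2 * n./2 + 2 = n.+1)%N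
                      & (2 * n./2 + 3 = n.+2)%N] by split; lia.
  rewrite n1 n2 n3 in DO; rewrite DO.
  by rewrite -!mul_polyC !polyCM !polyC_natr; ring.
rewrite B1_even //; last first.
  by move=> i oi; apply: monic_jacobi_parity; rewrite oddD /= on oi.
have [n2 n1] : (2 * n./2 + 2 = n.+2 /\ 2 * n./2 + 1 = n.+1)%N by split; lia.
rewrite n1 n2 in DE; rewrite DE scale0r addr0 -!mul_polyC !polyCM !polyC_natr.
by ring.
Qed.

(** * From the degree 4 identity to linear growth of [v] *)

Lemma hc_v3 a v (A d e : R) : v 0 = 1 -> v 1%N != 0 -> v 2%N != 0 -> A != 0 ->
  a 0 = A -> a 1%N = A * (v 2%N - 1) ->
  a 2%N = A * (v 2%N * (v 3%N - v 1%N) / v 1%N) ->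
  B1 v (monic_jacobi a 4) =
    d *: ('X * monic_jacobi a 3) + e *: monic_jacobi a 2 ->
  v 3%N = 2 * v 1%N.
Proof.
move=> v0 v1N v2N AN a0 a1 a2 /polyP H.
have P2 : monic_jacobi a 2 = 'X^2 - A%:P by rewrite /= a0; ring.
have P3 : monic_jacobi a 3 = 'X^3 - (A * v 2%N) *: 'X.
  rewrite monic_jacobiSS P2 a1 /= -mul_polyC !polyCM polyCB; ring.
(* [S] is a_0 + a_1 + a_2, where a_0 + a_1 = A v_2. *)
pose S := A * v 2%N * v 3%N / v 1%N.
have P4 : monic_jacobi a 4 = 'X^4 - S *: 'X^2 + (a 2%N * A)%:P.
  have -> : S = A * v 2%N + a 2%N by rewrite /S a2; field.
  by rewrite monic_jacobiSS P3 P2 -!mul_polyC !polyCM polyCD polyCM; ring.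
have := H 0; have := H 2%N; have := H 4%N.
rewrite !coef_B1 // P2 P3 P4 !(coefD, coefN, coefZ, coefXM, coefXn, coefX, coefC) /=.
rewrite ?(mulr0, mulr1, mul0r, addr0, add0r, subr0, oppr0, sub0r).
move=> dE eE /esym/eqP; rewrite mulrN oppr_eq0 mulf_eq0 (negbTE AN) orbF => /eqP e0.
move: eE; rewrite e0 -dE addr0 !mulrN => /oppr_inj.
(* With e = 0 and d = v_3 - 4, the x^2 coefficients give (v_1 - 2) S = (v_3 - 4) A v_2. In this form
   A v_2 cancels, leaving v_3 / v_1 = 2. *)
have -> : (v 1%N - 2%:R) * S = (v 3%N - (2 * (v 3%N / v 1%N))) * (A * v 2%N).
  by rewrite /S; field.
move/(mulIf (mulf_neq0 AN v2N))/addrI/oppr_inj => E.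
have : v 3%N / v 1%N = 2 by lra.
by move/(canRL (divfK v1N)).
Qed.

(** Second differences vanish within each parity class, so each class is an arithmetic progression
    fixed by its first two terms. *)
Lemma hc_v_linear v : v 0 = 1 -> v 3%N = 2 * v 1%N ->
  (forall n, v n.+4 = 2 * v n.+2 - v n) ->
  (forall k, v (2 * k + 1)%N = k.+1%:R * v 1%N) /\
  (forall k, v (2 * k)%N = 1 + k%:R * (v 2%N - 1)).
Proof.
move=> v0 v3 rec.
have step (f : nat -> R) : (forall k, f k.+2 = 2 * f k.+1 - f k) ->
    forall k, f k = f 0 + k%:R * (f 1%N - f 0).
  move=> fr k; suff: f k = f 0 + k%:R * (f 1%N - f 0) /\
      f k.+1 = f 0 + k.+1%:R * (f 1%N - f 0) by case.
  elim: k => [|k [IH0 IH1]]; first by split; ring.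
  by split; rewrite ?fr // IH1 IH0; ring.
split=> k.
  rewrite (step (fun k => v (2 * k + 1)%N)); first by rewrite /= v3; ring.
  by move=> j; rewrite !mulnS; apply: rec.
rewrite (step (fun k => v (2 * k)%N)); first by rewrite /= v0.
by move=> j; rewrite !mulnS; apply: rec.
Qed.

End HermiteChihara.

Theorem theorem6p2 (R : realType) (b0 : R) (v : nat -> R)
  (hb0 : 0 < b0)
  (hv0 : v 0%N = 1)
  (hmono : forall n : nat, v n <= v n.+1)
  (hrel : forall n p : nat, (2 <= n)%N -> (1 <= p)%N -> (2 * p <= n)%N ->
     v (n - 2)%N * v (2 * p - 1)%N
       + zindexed v (2 * p%:Z - 3) * v (n - 2 * p)%N
     = v n * zindexed v (2 * p%:Z - 3)
       + v (2 * p - 1)%N * v (n - 2 * p)%N)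
  (hincr : forall n : nat, (2 <= n)%N -> v (n - 2)%N < v n) :
  let psi := hc_poly b0 v in
  (exists delta beta : nat -> R,
      B1 v (psi 2%N) = delta 2%N *: ('X * psi 1%N) /\
      (forall n : nat, (3 <= n)%N ->
         B1 v (psi n) =
           delta n *: ('X * psi (n - 1)%N) + beta n *: psi (n - 2)%N))
  <->
  ((1 <= v 1%N /\ v 1%N <= v 2%N) /\
   (forall p : nat, (1 <= p)%N -> v (2 * p + 1)%N = (p + 1)%:R * v 1%N) /\
   (forall m : nat, (1 <= m)%N ->
      v (2 * m)%N = m%:R * v 2%N - (m - 1)%:R)).
Proof.
move=> psi.
have vgt0 n : 0 < v n.
  by elim: n => [|n IH]; [rewrite hv0 ltr01|exact: lt_le_trans (hmono n)].
have vN n : v n != 0 by rewrite gt_eqF.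
have bN i : hc_coef b0 v i != 0 by rewrite gt_eqF // hc_coef_gt0.
pose a i := hc_coef b0 v i ^+ 2; pose w n := \prod_(i < n) hc_coef b0 v i.
have wN n : w n != 0 by apply/prodf_neq0.
have psiE n : psi n = (w n)^-1 *: monic_jacobi a n by exact: jacobi_poly_monic.
have PE n : monic_jacobi a n = w n *: psi n by rewrite psiE scalerA mulfV ?scale1r.
have aS n : a n.+1 = b0 ^+ 2 * (v n.+1 * (v n.+2 - v n) / v 1%N).
  by have := hc_coef_sqr b0 vgt0 hincr (isT : 2 <= n.+2)%N; rewrite subn2.
split=> [[delta [beta [_ H]]]|[_ [vO vE]]].
  have v3 : v 3%N = 2 * v 1%N.
    have := B1_rescale (w 4%N) hv0 (wN 3%N) (wN 2%N) (H 4%N isT); rewrite -!PE.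
    apply: (hc_v3 (A := b0 ^+ 2)); rewrite ?aS ?hv0 //.
    - by rewrite expf_neq0 // gt_eqF.
    - by field.
  have [vO vE] : (forall k, v (2 * k + 1)%N = k.+1%:R * v 1%N) /\
      (forall k, v (2 * k)%N = 1 + k%:R * (v 2%N - 1)).
    apply: hc_v_linear => // n; apply: (mulIf (vN 1%N)).
    (* This reads v_(n+2) v_3 + v_1 v_n = v_(n+4) v_1 + v_3 v_n; with v_3 = 2 v_1 the factor v_1
       cancels. *)
    have := hrel n.+4 2%N isT isT isT.
    rewrite (_ : 2 * 2%N%:Z - 3 = 1%N) // (_ : n.+4 - 2 * 2 = n)%N; last by lia.
    by rewrite /= !subn2 v3 /= => E; lra.
  split; first by rewrite -{1}hv0 !hmono.
  split=> [p _|[//|m] _]; first by rewrite vO addn1.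
  by rewrite vE subSS subn0 mulrS; ring.
have vO' k : v (2 * k + 1)%N = k.+1%:R * v 1%N.
  by case: k => [|k]; [rewrite mul1r|rewrite vO // addn1].
have vE' k : v (2 * k)%N = 1 + k%:R * (v 2%N - 1).
  case: k => [|k]; first by rewrite hv0 mul0r addr0.
  by rewrite vE // subSS subn0 mulrS; ring.
(* Odd-indexed v increase by v_1, which cancels the denominator in [aS]. With [aO] this is the
   generalized Hermite pattern for A = b0^2 and s = v_2 - 1. *)
have aE k : a (2 * k)%N = b0 ^+ 2 * v (2 * k)%N.
  case: k => [|k]; first by rewrite hv0 mulr1.
  have := vO' k; have := vO' k.+1; rewrite mulnS !addn1 aS => -> ->.
  by field.
have aO k : a (2 * k + 1)%N = b0 ^+ 2 * (k.+1%:R * (v 2%N - 1)).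
  have := vO' k; have := vE' k.+1; rewrite mulnS !addn1 aS vE' => -> ->.
  by field.
have BP := B1_monic_jacobi hv0 vO' vE' aE aO.
have Bpsi n := B1_rescale (w n.+2)^-1 hv0 (invr_neq0 (wN n.+1)) (invr_neq0 (wN n)) (BP n).
(* [d] and [e] are indexed by the degree, two more than the index in [BP]. *)
pose d n := if odd n then (v 2%N - 3) / 2 * n.-1%:R else (v 1%N - 2) / 2 * n%:R.
pose e n := if odd n then (v 2%N - 3) / 2 * n.-1%:R * b0 ^+ 2 else 0.
exists (fun n => (w n)^-1 * d n / (w n.-1)^-1).
exists (fun n => (w n)^-1 * e n / (w n.-2)^-1).
(* Degree 2 is even, so its psi_0 term has coefficient 0. *)
split; first by rewrite !psiE Bpsi /= mulr0 mul0r scale0r addr0.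
case=> [|[|n]] // _; rewrite subn1 subn2 !psiE Bpsi /d /e /=.
by rewrite negbK.
Qed.
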